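(* Let $\beta\in\mathbb C$ with $|\beta|>1$ and let $\mathcal B$ be a finite alphabet of contiguous integers containing $0$. Suppose there exist non-negative integers $\ell$ and $s$ such that for every $n\geqslant0$ and all $x=\sum_{j=0}^n x_j\beta^j$, $y=\sum_{j=0}^n y_j\beta^j$ with $x_j,y_j\in\mathcal B$, the sum $x+y$ has a representation $x+y=\sum_{j=-s}^{n+\ell}z_j\beta^j$ with all $z_j\in\mathcal B$. Then, with $k=2(\ell+s)$, there exists a $k$-block $3$-local function performing parallel addition in base $\beta$ on the alphabet $\mathcal A=\mathcal B+\mathcal B$.
   Context: For an alphabet $\mathcal A$ and $k\geqslant1$, $\mathcal A_{(k)}=\{a_0+a_1\beta+\cdots+a_{k-1}\beta^{k-1}: a_i\in\mathcal A\}$. A map $\varphi:\mathcal C^{\mathbb Z}\to\mathcal D^{\mathbb Z}$ is $p$-local if there are $r,t\geqslant0$, $p=r+t+1$, and $\Phi:\mathcal C^p\to\mathcal D$ with $\varphi(u)_j=\Phi(u_{j+t}\cdots u_{j-r})$ for all $j$. A digit set conversion in base $\delta$ from $\mathcal C$ to $\mathcal D$ is a map $\mathcal C^{\mathbb Z}\to\mathcal D^{\mathbb Z}$ sending sequences with finitely many non-zero entries to such sequences and preserving $\sum_j u_j\delta^j$. A $k$-block $p$-local function performing parallel addition in base $\beta$ on $\mathcal A$ is a $p$-local digit set conversion in base $\beta^k$ from $\mathcal A_{(k)}+\mathcal A_{(k)}$ to $\mathcal A_{(k)}$. *)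

(* Defs.v *)
From mathcomp Require Export all_boot all_order all_algebra.
From mathcomp Require Export complex.
From mathcomp Require Export boolp classical_sets functions cardinality fsbigop.
From mathcomp Require Export set_interval reals.

Set Implicit Arguments.
Unset Strict Implicit.
Unset Printing Implicit Defensive.

Import Order.TTheory GRing.Theory Num.Theory.
Local Open Scope classical_set_scope.
Local Open Scope ring_scope.

Definition sumset (V : zmodType) (X Y : set V) : set V :=
  [set x + y | x in X & y in Y].

Definition contiguous (B : set int) : Prop :=
  forall a b c : int, B a -> B c -> a <= b <= c -> B b.

(* For k = 0 the sum is empty and the block alphabet is {0}. *)
Definition block_alphabet (R : realType) (beta : R[i]) (A : set int) (k : nat)
    : set R[i] :=
  [set \sum_(i < k) (a i)%:~R * beta ^+ i | a in
     [set a : 'I_k -> int | forall i, A (a i)]].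

Section Conversions.
Variable R : realType.
Implicit Types C D : set R[i].

(* Bi-infinite words over an alphabet C are functions int -> C, where the set C
   is coerced to the subtype of its elements. The window passed to Phi is the
   word u_(j+t) ... u_(j-r), indices decreasing. *)
Definition is_local C D (p : nat) (phi : (int -> C) -> (int -> D)) : Prop :=
  exists r t : nat, p = (r + t + 1)%N /\
  exists Phi : p.-tuple C -> D,
  forall (u : int -> C) (j : int),
    phi u j = Phi [tuple u (j + t%:Z - i%:Z) | i < p].

Definition finitely_supported C (u : int -> C) : Prop :=
  finite_set [set j | val (u j) != 0].

Definition word_value C (delta : R[i]) (u : int -> C) : R[i] :=
  \sum_(j \in [set: int]) val (u j) * delta ^ j.

Definition digit_set_conversion C D (delta : R[i])
    (phi : (int -> C) -> (int -> D)) : Prop :=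
  forall u : int -> C, finitely_supported u ->
    finitely_supported (phi u) /\
    word_value delta (phi u) = word_value delta u.

Definition block_parallel_addition (k p : nat) (beta : R[i]) (A : set int)
    (phi : (int -> sumset (block_alphabet beta A k) (block_alphabet beta A k)) ->
           (int -> block_alphabet beta A k)) : Prop :=
  is_local p phi /\ digit_set_conversion (beta ^+ k) phi.

End Conversions.

(* Main.v *)
Require Import Defs.
From mathcomp Require Import all_boot all_order all_algebra.
From mathcomp Require Import complex.
From mathcomp Require Import boolp classical_sets functions cardinality fsbigop.
From mathcomp Require Import set_interval reals.
From mathcomp Require Import zify ring.

Set Implicit Arguments.
Unset Strict Implicit.
Unset Printing Implicit Defensive.

Import Order.TTheory GRing.Theory Num.Theory.
Local Open Scope classical_set_scope.
Local Open Scope ring_scope.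

(** Applying the hypothesis twice rewrites a sum of four [k]-digit numbers over
    [B] with digits of [B] at the positions [-2s, ..., k - 1 + 2l]. The digits
    at positions [0, ..., k - 1] stay in their block, the [2s] low ones are
    carried to the block below, where they occupy positions
    [k - 2s, ..., k - 1], and the [2l] high ones to the block above, where they
    occupy positions [0, ..., 2l - 1]. As [k = 2l + 2s], the two incoming
    carries fill each block exactly without overlapping, so every new digit is
    a sum of two elements of [B]. *)

(** * Evaluation of digit strings *)

Definition digit_eval (K : pzRingType) (beta : K) (m : nat) (x : nat -> int) : K :=
  \sum_(j < m) (x j)%:~R * beta ^+ j.

Lemma digit_eval_cat (K : comPzRingType) (beta : K) (m n : nat) (x : nat -> int) :
  digit_eval beta (m + n) x =
  digit_eval beta m x + beta ^+ m * digit_eval beta n (fun i => x (m + i)%N).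
Proof.
rewrite /digit_eval big_split_ord; congr (_ + _).
by rewrite mulr_sumr; apply: eq_bigr => i _ /=; rewrite exprD; ring.
Qed.

Lemma digit_evalD (K : pzRingType) (beta : K) (m : nat) (x y : nat -> int) :
  digit_eval beta m (fun i => x i + y i) =
  digit_eval beta m x + digit_eval beta m y.
Proof.
by rewrite -big_split; apply: eq_bigr => i _; rewrite intrD mulrDl.
Qed.

Lemma eq_digit_eval (K : pzRingType) (beta : K) (m : nat) (x y : nat -> int) :
  (forall i, (i < m)%N -> x i = y i) -> digit_eval beta m x = digit_eval beta m y.
Proof. by move=> xy; apply: eq_bigr => i _; rewrite xy. Qed.

Lemma digit_eval0 (K : pzRingType) (beta : K) (m : nat) :
  digit_eval beta m (fun=> 0) = 0.
Proof. by rewrite /digit_eval big1// => i _; rewrite mul0r. Qed.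

(** * Sums over the integers with finite support *)

Lemma fsum_int_itv (V : zmodType) (s m : nat) (F : int -> V) :
  \sum_(j \in [set j : int | - s%:Z <= j < m%:Z - s%:Z]) F j =
  \sum_(i < m) F (i%:Z - s%:Z).
Proof.
rewrite (@fsbig_ord V 0 +%R m (fun i => F (i%:Z - s%:Z))).
apply: (@reindex_fsbig V 0 +%R nat int (fun i => i%:Z - s%:Z)).
split=> [i /=|i j _ _|j /=].
- lia.
- by move=> /addIr[].
- by move=> jm; exists `|(j + s%:Z)%R|%N => /=; lia.
Qed.

Lemma finite_suppD (I : choiceType) (V : zmodType) (f g : I -> V) :
  finite_set [set j | f j != 0] -> finite_set [set j | g j != 0] ->
  finite_set [set j | f j + g j != 0].
Proof.
move=> finf fing.
apply: (@sub_finite_set _ _ ([set j | f j != 0] `|` [set j | g j != 0])); last first.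
  by rewrite finite_setU.
move=> j /= fgj; have [f0|] := eqVneq (f j) 0; last by left.
by right; move: fgj; rewrite f0 add0r.
Qed.

(** A sum with infinite support is 0 by convention, hence the finiteness assumptions; all three sums
    are restricted to the union of both supports. *)
Lemma fsumD (I : choiceType) (V : zmodType) (f g : I -> V) :
  finite_set [set j | f j != 0] -> finite_set [set j | g j != 0] ->
  \sum_(j \in [set: I]) (f j + g j) =
  \sum_(j \in [set: I]) f j + \sum_(j \in [set: I]) g j.
Proof.
move=> finf fing.
pose S := [set j | f j != 0] `|` [set j | g j != 0].
have S0 j : ~ S j -> f j = 0 /\ g j = 0.
  by move=> /not_orP[/negP/negPn/eqP ? /negP/negPn/eqP ?].
rewrite -!(@fsbig_widen _ _ _ _ S [set: I])//.
- by apply: fsbig_split; rewrite finite_setU.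
- by move=> j [_ /S0[]].
- by move=> j [_ /S0[]].
- by move=> j [_ /S0[/= -> ->]]; rewrite addr0.
Qed.

Lemma fsum_shift (V : zmodType) (f : int -> V) (a : int) :
  \sum_(j \in [set: int]) f (j + a) = \sum_(j \in [set: int]) f j.
Proof.
apply/esym/(@reindex_fsbigT V 0 +%R int int (fun j => j + a)).
by exists (fun j => j - a) => j; rewrite ?addrK ?subrK.
Qed.

Lemma finite_supp_shift (V : zmodType) (f : int -> V) (a : int) :
  finite_set [set j | f j != 0] -> finite_set [set j | f (j + a) != 0].
Proof.
move=> /(finite_image (fun j => j - a)); apply: sub_finite_set => j /= fj.
by exists (j + a); rewrite ?addrK.
Qed.

(** * Carrying preserves finite support and value *)

Section Carries.
Variables (K : fieldType) (d : K) (lo mid hi : K -> K).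
Hypotheses (d0 : d != 0) (lo0 : lo 0 = 0) (mid0 : mid 0 = 0) (hi0 : hi 0 = 0).

Definition carry_step (w : int -> K) (j : int) : K :=
  mid (w j) + hi (w (j - 1)) + lo (w (j + 1)).

(** The map [h] may depend on the position, so that weighted terms such as [mid x * d ^ j] are
    covered too. *)
Let finite_supp_comp (h : int -> K -> K) (w : int -> K) :
  (forall j, h j 0 = 0) -> finite_set [set j | w j != 0] ->
  finite_set [set j | h j (w j) != 0].
Proof.
move=> h0; apply: sub_finite_set => j /=; apply: contra_neq => ->; exact: h0.
Qed.

Lemma finite_supp_carry_step (w : int -> K) :
  finite_set [set j | w j != 0] -> finite_set [set j | carry_step w j != 0].
Proof.
move=> finw; apply: finite_suppD; first apply: finite_suppD.
- exact: (@finite_supp_comp (fun=> mid)).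
- apply: (@finite_supp_shift _ (fun j => hi (w j))).
  exact: (@finite_supp_comp (fun=> hi)).
- apply: (@finite_supp_shift _ (fun j => lo (w j))).
  exact: (@finite_supp_comp (fun=> lo)).
Qed.

(** A factor [d] or [d^-1] at position [j] amounts to a move to position [j + 1] or [j - 1], so
    carrying merely shifts the index in two of three sums. *)
Lemma fsum_carry_step (w : int -> K) :
  finite_set [set j | w j != 0] ->
  (forall j, w j = mid (w j) + d * hi (w j) + d^-1 * lo (w j)) ->
  \sum_(j \in [set: int]) carry_step w j * d ^ j =
  \sum_(j \in [set: int]) w j * d ^ j.
Proof.
move=> finw wE.
pose M j := mid (w j) * d ^ j.
pose H j := d * hi (w j) * d ^ j.
pose L j := d^-1 * lo (w j) * d ^ j.
have finM : finite_set [set j | M j != 0].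
  by apply: (@finite_supp_comp (fun j x => mid x * d ^ j)) => // j;
    rewrite mid0 mul0r.
have finH : finite_set [set j | H j != 0].
  by apply: (@finite_supp_comp (fun j x => d * hi x * d ^ j)) => // j;
    rewrite hi0 mulr0 mul0r.
have finL : finite_set [set j | L j != 0].
  by apply: (@finite_supp_comp (fun j x => d^-1 * lo x * d ^ j)) => // j;
    rewrite lo0 mulr0 mul0r.
rewrite (eq_fsbigr (fun j => M j + H (j - 1) + L (j + 1))); last first.
  move=> j _; rewrite /carry_step /M /H /L !expfzDr// exprN1 expr1z.
  by field.
rewrite [RHS](eq_fsbigr (fun j => M j + H j + L j)); last first.
  by move=> j _; rewrite {1}wE /M /H /L !mulrDl.
have finMH := finite_suppD finM finH.
have finH1 := finite_supp_shift (-1) finH.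
have finL1 := finite_supp_shift 1 finL.
have finMH1 := finite_suppD finM finH1.
rewrite fsumD// fsumD// [RHS]fsumD// [in RHS]fsumD//.
by rewrite (fsum_shift H) (fsum_shift L).
Qed.

End Carries.

(** * Adding two and four digit strings over [B] *)

Section DigitAddition.
Variables (K : fieldType) (beta : K) (B : set int) (l s : nat).
Hypotheses (beta0 : beta != 0) (B0 : B 0).
Hypothesis hsum : forall (n : nat) (x y : nat -> int),
  (forall j, (j <= n)%N -> B (x j)) -> (forall j, (j <= n)%N -> B (y j)) ->
  exists z : int -> int,
    (forall j : int, - s%:Z <= j <= (n + l)%:Z -> B (z j)) /\
    \sum_(j < n.+1) (x j)%:~R * beta ^+ j + \sum_(j < n.+1) (y j)%:~R * beta ^+ j
    = \sum_(j \in [set j : int | - s%:Z <= j <= (n + l)%:Z]) (z j)%:~R * beta ^ j.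

(** The factor [beta ^+ s] clears the fractional positions, so that the result is again a digit
    string and the lemma can be iterated. *)
Lemma digit_eval_add2 (m : nat) (x y : nat -> int) :
  (forall i, B (x i)) -> (forall i, B (y i)) ->
  exists2 z : nat -> int, forall i, B (z i) &
    beta ^+ s * (digit_eval beta m x + digit_eval beta m y) =
    digit_eval beta (m + (l + s)) z.
Proof.
move=> Bx By; case: m => [|n].
  (* The empty string is apart: [hsum] speaks of [n.+1] digits. *)
  by exists (fun=> 0) => //; rewrite digit_eval0 /digit_eval !big_ord0 addr0 mulr0.
have [z [Bz zE]] := hsum (fun j _ => Bx j) (fun j _ => By j) (n := n).
pose m := (n.+1 + (l + s))%N.
(* Index [i] stands for exponent [i - s]; beyond the window the default 0 stays in [B]. *)
exists (fun i => if (i < m)%N then z (i%:Z - s%:Z) else 0).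
  by move=> i; case: ifP => // im; apply: Bz; rewrite /m in im; lia.
rewrite /digit_eval zE.
have -> : [set j : int | - s%:Z <= j <= (n + l)%:Z] =
          [set j : int | - s%:Z <= j < m%:Z - s%:Z].
  by apply/seteqP; split=> j /=; rewrite /m; lia.
rewrite fsum_int_itv mulr_sumr; apply: eq_bigr => i _.
by rewrite ltn_ord expfzDr// -exprnN -exprnP; field; rewrite expf_neq0.
Qed.

(** Each pair is added first, then the two results, of length [m + (l + s)]; both rounds contribute
    a factor [beta ^+ s]. *)
Lemma digit_eval_add4 (m : nat) (x y x' y' : nat -> int) :
  (forall i, B (x i)) -> (forall i, B (y i)) ->
  (forall i, B (x' i)) -> (forall i, B (y' i)) ->
  exists2 z : nat -> int, forall i, B (z i) &
    beta ^+ (2 * s) * (digit_eval beta m x + digit_eval beta m y +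
                       (digit_eval beta m x' + digit_eval beta m y')) =
    digit_eval beta (m + 2 * (l + s)) z.
Proof.
move=> Bx By Bx' By'.
have [z Bz zE] := digit_eval_add2 m Bx By.
have [z' Bz' z'E] := digit_eval_add2 m Bx' By'.
have [t Bt tE] := digit_eval_add2 (m + (l + s)) Bz Bz'.
exists t => //; rewrite mul2n -addnn exprD -mulrA mulrDr zE z'E tE.
by congr digit_eval; lia.
Qed.

End DigitAddition.

(** * Block alphabets and the conversion *)

Lemma block_alphabetE (R : realType) (beta : R[i]) (A : set int) (k : nat)
    (a : nat -> int) :
  (forall i, A (a i)) -> block_alphabet beta A k (digit_eval beta k a).
Proof. by move=> Aa; exists (fun i : 'I_k => a i). Qed.

Lemma block_alphabet_sumset (R : realType) (beta : R[i]) (B : set int) (k : nat)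
    (w : R[i]) : B 0 -> block_alphabet beta (sumset B B) k w ->
  exists x y : nat -> int, [/\ forall i, B (x i), forall i, B (y i) &
    w = digit_eval beta k x + digit_eval beta k y].
Proof.
move=> B0 [a aB <-].
have /choice[f fP] : forall i : 'I_k, exists p : int * int,
    [/\ B p.1, B p.2 & a i = p.1 + p.2].
  by move=> i; have [x Bx [y By xy]] := aB i; exists (x, y).
pose F (g : int * int -> int) i := if insub i is Some j then g (f j) else 0.
exists (F fst), (F snd); split.
- by move=> i; rewrite /F; case: insubP => // j _ _; case: (fP j).
- by move=> i; rewrite /F; case: insubP => // j _ _; case: (fP j).
rewrite -digit_evalD; apply: eq_bigr => i _.
by rewrite /F valK; have [_ _ ->] := fP i.
Qed.

Theorem theorem19 (R : realType) (beta : R[i]) (B : set int) (l s : nat)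
  (hbeta : 1 < `|beta|)
  (Bfin : finite_set B) (Bcontig : contiguous B) (B0 : B 0)
  (hsum : forall (n : nat) (x y : nat -> int),
     (forall j, (j <= n)%N -> B (x j)) ->
     (forall j, (j <= n)%N -> B (y j)) ->
     exists z : int -> int,
       (forall j : int, - s%:Z <= j <= (n + l)%:Z -> B (z j)) /\
       \sum_(j < n.+1) (x j)%:~R * beta ^+ j
         + \sum_(j < n.+1) (y j)%:~R * beta ^+ j
       = \sum_(j \in [set j : int | - s%:Z <= j <= (n + l)%:Z])
           (z j)%:~R * beta ^ j) :
  exists phi, @block_parallel_addition R (2 * (l + s)) 3 beta (sumset B B) phi.
Proof.
have beta0 : beta != 0 by rewrite -normr_gt0 (lt_trans ltr01).
set k := (2 * (l + s))%N.
pose D := block_alphabet beta (sumset B B) k.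
have kE : k = (2 * l + 2 * s)%N by rewrite /k; lia.
(* The zero string is imposed at [w = 0] so that zero entries emit no carry, which keeps supports
   finite. Digits lie in [B] for every [w], so the local rule is total. *)
have /choice[Z ZP] : forall w : R[i], exists z : nat -> int,
    [/\ forall i, B (z i), w = 0 -> z = (fun=> 0) &
      sumset D D w -> beta ^+ (2 * s) * w = digit_eval beta (k + k) z].
  move=> w; have [->|w0] := eqVneq w 0.
    by exists (fun=> 0); split=> //; rewrite digit_eval0 mulr0.
  have [[a Da [b Db wE]]|] := pselect (sumset D D w); last first.
    by move=> nDw; exists (fun=> 0).
  have [x [y [Bx By aE]]] := block_alphabet_sumset B0 Da.
  have [x' [y' [Bx' By' bE]]] := block_alphabet_sumset B0 Db.
  have [z Bz zE] := digit_eval_add4 beta0 B0 hsum k Bx By Bx' By'.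
  by exists z; split=> // [/eqP|_]; [rewrite (negPf w0)|rewrite -wE aE bE zE].
have Z0 : Z 0 = (fun=> 0) by have [_ ->] := ZP 0.
(* Index [i] of [Z w] stands for exponent [i - 2 * s]. Seen from the block below, the low digits
   gain a factor [beta ^+ k], and [k - 2 * s = 2 * l] gives the power in [lo]. *)
pose mid w := digit_eval beta k (fun i => Z w (2 * s + i)%N).
pose hi w := digit_eval beta (2 * l) (fun i => Z w (2 * s + k + i)%N).
pose lo w := beta ^+ (2 * l) * digit_eval beta (2 * s) (Z w).
have mid0 : mid 0 = 0 by rewrite /mid Z0 digit_eval0.
have hi0 : hi 0 = 0 by rewrite /hi Z0 digit_eval0.
have lo0 : lo 0 = 0 by rewrite /lo Z0 digit_eval0 mulr0.
have splitE w : sumset D D w ->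
    w = mid w + beta ^+ k * hi w + (beta ^+ k)^-1 * lo w.
  move=> Dw; have [_ _ /(_ Dw)] := ZP w.
  have -> : (k + k = 2 * s + k + 2 * l)%N by lia.
  rewrite (digit_eval_cat _ (2 * s + k)) (digit_eval_cat _ (2 * s) k).
  rewrite -/(mid w) -/(hi w) (exprD _ (2 * s) k) /lo => wE.
  have bkE : beta ^+ k = beta ^+ (2 * l) * beta ^+ (2 * s) by rewrite kE exprD.
  (* After scaling by [beta ^+ (2 * s)], a field identity in two nonzero unknowns [p] and [q]
     remains. *)
  apply: (mulfI (expf_neq0 (2 * s) beta0)); rewrite {}wE bkE.
  move: (expf_neq0 (2 * s) beta0) (expf_neq0 (2 * l) beta0).
  move: (beta ^+ (2 * s)) (beta ^+ (2 * l)) => p q p0 q0.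
  by field; rewrite p0 q0.
have stepD a b c : D (mid b + hi c + lo a).
  (* The string [e] concatenates the carry from [c], the block below, and the carry from [a], the
     block above. *)
  pose e i := if (i < 2 * l)%N then Z c (2 * s + k + i)%N else Z a (i - 2 * l)%N.
  suff -> : mid b + hi c + lo a =
      digit_eval beta k (fun i => Z b (2 * s + i)%N + e i).
    apply: block_alphabetE => i; exists (Z b (2 * s + i)%N); first by case: (ZP b).
    by exists (e i) => //; rewrite /e; case: ifP => _; [case: (ZP c)|case: (ZP a)].
  rewrite digit_evalD -addrA; congr (_ + _).
  rewrite [in RHS]kE digit_eval_cat; congr (_ + _ * _).
    by apply: eq_digit_eval => i il; rewrite /e il.
  by apply: eq_digit_eval => i il; rewrite /e ltnNge leq_addr/= addKn.
pose out (a b c : R[i]) : D := exist (fun x => x \in D) _ (mem_set (stepD a b c)).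
exists (fun u j => out (val (u (j + 1))) (val (u j)) (val (u (j - 1)))).
split.
  (* With [r = t = 1] the window lists the entries at [j + 1], [j], [j - 1], in the order of the
     arguments of [out]. *)
  exists 1, 1; split=> //.
  exists (fun t => out (val (tnth t 0)) (val (tnth t 1)) (val (tnth t 2%:R))).
  move=> u j; rewrite !tnth_mktuple.
  by congr (out (val (u _)) (val (u _)) (val (u _))) => /=; lia.
move=> u finu; pose w j := val (u j).
have dk0 : beta ^+ k != 0 by rewrite expf_neq0.
split; first exact: (@finite_supp_carry_step _ lo mid hi lo0 mid0 hi0 w finu).
apply: (@fsum_carry_step _ (beta ^+ k) lo mid hi dk0 lo0 mid0 hi0 w finu) => j.
exact/splitE/(set_valP (u j)).
Qed.
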